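(* Let $0<q<1$, $N\in\mathbb N$, $n\in\{1,\dots,N-1\}$ and $a>0$ be fixed, and consider the q-Racah polynomial $R_n^{(\alpha,\beta)}(\cdot;q)$ with $\alpha>-1$, $-1<\beta<2a$. If $a\ge 1/2$, the zeros of $R_n^{(\alpha,\beta)}(\cdot;q)$ are strictly decreasing functions of $\alpha$ on $(-1,\infty)$ and strictly increasing functions of $\beta$ on $(-1,2a)$. If $0<a<1/2$, the zeros of $R_n^{(\alpha,\beta)}(\cdot;q)$ are strictly decreasing functions of $\alpha$ on $(-1,\infty)$ for each $\beta\in(a-1/2,2a)$ and strictly increasing functions of $\beta$ on $(a-1/2,2a)$.
   Context: The q-Racah polynomial is the polynomial of degree $n$ in the variable $X=x(s)=(q^s+q^{-s})/2$ given by $$R_n^{(\alpha,\beta)}(X;q)={}_4\phi_3\left(\left.{q^{-n},\,q^{\alpha+\beta+n+1},\,q^{a-s},\,q^{s+a}\atop q^{2a+\alpha+N},\,q^{\beta+1},\,q^{1-N}}\right|q,q\right)=\sum_{k=0}^n\frac{(q^{-n};q)_k(q^{\alpha+\beta+n+1};q)_k(q^{a-s};q)_k(q^{s+a};q)_k}{(q^{2a+\alpha+N};q)_k(q^{\beta+1};q)_k(q^{1-N};q)_k(q;q)_k}q^k,$$ where $(u;q)_k=\prod_{j=0}^{k-1}(1-uq^j)$. Zeros are zeros in the variable $X$; there are $n$ of them, real and distinct, lying in $(x(a),x(a+N-1))$. The statement refers to each zero (the zeros being arranged in increasing order) as a function of one parameter, the other parameters being fixed. *)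

(* Defs.v *)
From mathcomp Require Import all_boot all_order all_algebra.
From mathcomp Require Import polyrcf.
From mathcomp Require Import reals exp.
From mathcomp Require Import ring.

Set Implicit Arguments.
Unset Strict Implicit.
Unset Printing Implicit Defensive.

Import Order.TTheory GRing.Theory Num.Theory.
Local Open Scope ring_scope.

Definition qpoch (R : realType) (q u : R) (k : nat) : R :=
  \prod_(j < k) (1 - u * q ^+ j).

(* The lattice x(s) = (q^s + q^-s) / 2. *)
Definition qlattice (R : realType) (q s : R) : R :=
  (q `^ s + q `^ (- s)) / 2.

(* (q^(a-s); q)_k (q^(a+s); q)_k as a polynomial in X = x(s): its j-th factor
   (1 - q^(a-s+j)) (1 - q^(a+s+j)) equals 1 - 2 X q^(a+j) + q^(2(a+j)).
   See [qRacah_basisE]. *)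
Definition qRacah_basis (R : realType) (q a : R) (k : nat) : {poly R} :=
  \prod_(j < k) ((1 + (q `^ a * q ^+ j) ^+ 2)%:P - (2 * (q `^ a * q ^+ j)) *: 'X).

Definition qRacah_coef (R : realType) (q : R) (N n : nat) (a alpha beta : R)
    (k : nat) : R :=
  qpoch q (q `^ (- n%:R)) k * qpoch q (q `^ (alpha + beta + n%:R + 1)) k /
  (qpoch q (q `^ (2 * a + alpha + N%:R)) k * qpoch q (q `^ (beta + 1)) k *
   qpoch q (q `^ (1 - N%:R)) k * qpoch q q k) * q ^+ k.

Definition qRacah (R : realType) (q : R) (N n : nat) (a alpha beta : R) :
    {poly R} :=
  \sum_(k < n.+1) qRacah_coef q N n a alpha beta k *: qRacah_basis q a k.

(* The i-th zero (i = 0, ..., n - 1) in increasing order. [rootsR p] is the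
   strictly increasing list of the real roots of [p]; that it has n entries
   here is not built into the definition. *)
Definition qRacah_zero (R : realType) (q : R) (N n : nat) (a alpha beta : R)
    (i : nat) : R :=
  nth 0 (rootsR (qRacah q N n a alpha beta)) i.

Lemma qRacah_basisE (R : realType) (q a s : R) (k : nat) : 0 < q ->
  (qRacah_basis q a k).[qlattice q s] =
  qpoch q (q `^ (a - s)) k * qpoch q (q `^ (s + a)) k.
Proof.
move=> q0; rewrite /qRacah_basis /qpoch horner_prod -big_split /=.
apply: eq_bigr => j _; rewrite hornerD hornerN hornerZ hornerC hornerX /qlattice.
have qs0 : q `^ s != 0 by rewrite gt_eqF// powR_gt0.
have q_neq0 : q != 0 by rewrite gt_eqF.
rewrite !powRD ?q_neq0 ?implybT// powRN.
by field.
Qed.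

Lemma qRacahE (R : realType) (q : R) (N n : nat) (a alpha beta s : R) : 0 < q ->
  (qRacah q N n a alpha beta).[qlattice q s] =
  \sum_(k < n.+1)
    qpoch q (q `^ (- n%:R)) k * qpoch q (q `^ (alpha + beta + n%:R + 1)) k *
    qpoch q (q `^ (a - s)) k * qpoch q (q `^ (s + a)) k /
    (qpoch q (q `^ (2 * a + alpha + N%:R)) k * qpoch q (q `^ (beta + 1)) k *
     qpoch q (q `^ (1 - N%:R)) k * qpoch q q k) * q ^+ k.
Proof.
move=> q0; rewrite /qRacah horner_sum; apply: eq_bigr => k _.
rewrite hornerZ qRacah_basisE// /qRacah_coef.
by ring.
Qed.

(* Main.v *)
Require Import Defs.
From mathcomp Require Import all_boot all_order all_algebra.
From mathcomp Require Import polyrcf.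
From mathcomp Require Import reals exp.
From mathcomp Require Import ring lra zify.

(* On the nodes x(a + k), k < N, the q-Racah polynomials are eigenfunctions of a
   second-order difference operator which is symmetric for a positive weight;
   as it maps the basis element of index k to a combination of those of index k
   and k - 1, this gives their orthogonality.  The quotient w(k + 1) / w(k) of
   consecutive weights decreases in alpha and increases in beta.
   Zeros are compared without differentiating.  They are the eigenvalues of the
   compressed multiplication by X, whose Rayleigh quotient at f is
   sum w X f^2 / sum w f^2; for every fixed f it increases strictly when w is
   multiplied by an increasing function (Chebyshev's sum inequality), hence so
   do the eigenvalues, by the Courant-Fischer principle. *)

Set Implicit Arguments.
Unset Strict Implicit.
Unset Printing Implicit Defensive.

Import Order.TTheory GRing.Theory Num.Theory.
Local Open Scope ring_scope.

(** * Sums over the nodes, and a sign rule for orthogonal polynomials *)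

Definition nodesum {R : comNzRingType} (N : nat) (w y : nat -> R) (f : {poly R}) : R :=
  \sum_(x < N) w x * f.[y x].

Lemma nodesumD (R : comNzRingType) N (w y : nat -> R) f g :
  nodesum N w y (f + g) = nodesum N w y f + nodesum N w y g.
Proof.
by rewrite -big_split /=; apply: eq_bigr => x _; rewrite hornerD mulrDr.
Qed.

Lemma nodesumZ (R : comNzRingType) N (w y : nat -> R) c f :
  nodesum N w y (c *: f) = c * nodesum N w y f.
Proof.
by rewrite mulr_sumr; apply: eq_bigr => x _; rewrite hornerZ mulrCA.
Qed.

Lemma nodesum0 (R : comNzRingType) N (w y : nat -> R) : nodesum N w y 0 = 0.
Proof. by rewrite /nodesum big1// => x _; rewrite horner0 mulr0. Qed.

Definition orthogonal_below {R : comNzRingType} (N : nat) (w y : nat -> R) (n : nat)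
    (P : {poly R}) :=
  forall f : {poly R}, (size f <= n)%N -> nodesum N w y (P * f) = 0.

Lemma size_mul_leq (R : idomainType) (p q : {poly R}) a b k :
  (size p <= a)%N -> (size q <= b)%N -> (a + b <= k.+1)%N -> (size (p * q)%R <= k)%N.
Proof. by move=> pa qb abk; rewrite (leq_trans (size_polyMleq _ _))//; lia. Qed.

Lemma size_mulXsubC_leq (R : idomainType) (p : {poly R}) z k :
  (size (p * ('X - z%:P))%R <= k.+1)%N -> (size p <= k)%N.
Proof.
have [->|p0] := eqVneq p 0; first by rewrite size_poly0.
by rewrite size_Mmonic ?monicXsubC// size_XsubC addn2.
Qed.

(* Stands in for Gauss quadrature: peeling off a root z of P, write
   u = d m + (X - z) v where m is the product over the remaining roots; the cross
   terms of L (h u)^2 are multiples of P by polynomials of degree below n. *)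
Lemma gauss_sign (R : realFieldType) N n (w y : nat -> R) (P L : {poly R}) :
  (forall x, (x < N)%N -> 0 <= w x) ->
  orthogonal_below N w y n P -> size P = n.+1 -> (size L <= 2)%N ->
  forall (s : seq R) (h u : {poly R}), uniq s ->
  P = h * \prod_(z <- s) ('X - z%:P) -> (size u <= size s)%N ->
  {in s, forall z, 0 <= L.[z]} -> 0 <= nodesum N w y (L * (h * u) ^+ 2).
Proof.
move=> w_ge0 orthP sizeP sizeL; elim=> [|z s IHs] h u.
  move=> _ _; rewrite leqn0 size_poly_eq0 => /eqP-> _.
  by rewrite mulr0 expr0n mulr0 nodesum0.
rewrite cons_uniq big_cons => /andP[zs uniq_s] defP size_u L_ge0.
set m := \prod_(_ <- _) _ in defP.
have mz : m.[z] != 0 by rewrite -rootE root_prod_XsubC.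
pose d := u.[z] / m.[z].
have /factor_theorem[v defu] : root (u - d *: m) z.
  by rewrite rootE hornerD hornerN hornerZ divfK// subrr.
have /factor_theorem[l defL] : root (L - L.[z]%:P) z.
  by rewrite rootE hornerD hornerN hornerC subrr.
have size_m : size m = (size s).+1 by rewrite size_prod_XsubC.
have h_neq0 : h != 0.
  by apply: contra_eq_neq sizeP => /eqP/eqP h0; rewrite defP h0 mul0r size_poly0.
have size_h : (size h + size s)%N = n.
  move: sizeP; rewrite defP size_Mmonic ?monicMl ?monicXsubC ?monic_prod_XsubC//.
  rewrite mulrC size_Mmonic ?monicXsubC ?monic_neq0 ?monic_prod_XsubC//.
  by rewrite size_m size_XsubC; lia.
have size_h_le : (size h <= n - size s)%N by rewrite -size_h addnK.
have s_lt : (size s < n)%N by rewrite -size_h -addn1 addnC leq_add2r size_poly_gt0.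
have size_v : (size v <= size s)%N.
  apply: (@size_mulXsubC_leq _ _ z); rewrite -defu (leq_trans (size_polyD _ _))//.
  by rewrite size_polyN geq_max size_u (leq_trans (size_scale_leq _ _))// size_m.
have size_l : (size l <= 1)%N.
  apply: (@size_mulXsubC_leq _ _ z); rewrite -defL (leq_trans (size_polyD _ _))//.
  by rewrite size_polyN geq_max sizeL (leq_trans (size_polyC_leq1 _)).
(* The first term is a square with coefficient [L.[z] * d ^+ 2], nonnegative by hypothesis. The last
   has the original shape with the root [z] moved from the list into [h], so the induction
   hypothesis applies to it. *)
have -> : L * (h * u) ^+ 2 = (L.[z] * d ^+ 2) *: (h * m) ^+ 2
   + P * (d ^+ 2 *: (l * (h * m)) + (2 * d) *: (L * (h * v)))
   + L * ((h * ('X - z%:P)) * v) ^+ 2.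
  have eqL : L = l * ('X - z%:P) + L.[z]%:P by rewrite -defL subrK.
  have equ : u = v * ('X - z%:P) + d *: m by rewrite -defu subrK.
  rewrite [in LHS]equ defP -!mul_polyC !polyCM.
  move: (L.[z]%:P) ('X - z%:P) eqL => lz X' ->.
  ring.
rewrite !nodesumD nodesumZ orthP ?addr0.
  apply: addr_ge0.
    apply: mulr_ge0; first by rewrite mulr_ge0 ?sqr_ge0// L_ge0 ?mem_head.
    by apply: sumr_ge0 => x _; rewrite horner_exp mulr_ge0 ?sqr_ge0 ?w_ge0//.
  apply: IHs => //; first by rewrite defP mulrA.
  by move=> t ts; apply: L_ge0; rewrite inE ts orbT.
rewrite (leq_trans (size_polyD _ _))// geq_max !(leq_trans (size_scale_leq _ _))//.
  apply: (@size_mul_leq _ _ _ 2 n.-1) => //; last by lia.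
  by apply: (@size_mul_leq _ _ _ (n - size s) (size s)) => //; lia.
apply: (@size_mul_leq _ _ _ 1 n) => //.
by apply: (@size_mul_leq _ _ _ (n - size s) (size s).+1) => //; [exact: eq_leq | lia].
Qed.

(** * Comparison of the zeros for two weights *)

(** Symmetrising the difference of the two sides gives half the double sum of [T k l]. As [y] and
    [w2 / w1] both increase, the first two factors of [T k l] have the same sign; the pair [(i, j)]
    makes the sum strictly positive. The monotonicity of [w2 / w1] is stated cross-multiplied. *)
Lemma chebyshev_sum_lt (R : realDomainType) N (y w1 w2 g : 'I_N -> R) (i j : 'I_N) :
  {homo y : k l / (k < l)%N >-> k < l} ->
  (forall k l : 'I_N, (k < l)%N -> w1 l * w2 k < w1 k * w2 l) ->
  (forall k, 0 <= g k) -> (i < j)%N -> 0 < g i -> 0 < g j ->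
  (\sum_k y k * (w1 k * g k)) * (\sum_k w2 k * g k)
    < (\sum_k y k * (w2 k * g k)) * (\sum_k w1 k * g k).
Proof.
move=> ylt wlt g_ge0 ij gi gj.
pose T k l := (y k - y l) * (w2 k * w1 l - w1 k * w2 l) * (g k * g l).
have T_ge0 k l : 0 <= T k l.
  rewrite /T; apply: mulr_ge0; last exact: mulr_ge0.
  have [kl|lk|/val_inj->] := ltngtP k l; last by rewrite subrr mul0r.
    by apply: mulr_le0; rewrite subr_le0 ltW ?ylt// mulrC wlt.
  by rewrite mulr_ge0// subr_ge0 ltW ?ylt// [w2 k * _]mulrC wlt.
have Tij : 0 < T i j.
  apply: mulr_gt0; last exact: mulr_gt0.
  rewrite nmulr_rgt0 subr_lt0 ?ylt//.
  by rewrite mulrC wlt.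
have : 0 < \sum_k \sum_l T k l.
  apply: (lt_le_trans Tij); rewrite (bigD1 i)//= (bigD1 j)//= -addrA lerDl.
  by rewrite addr_ge0 ?sumr_ge0// => k _; rewrite sumr_ge0.
have -> : \sum_k \sum_l T k l =
    2 * ((\sum_k y k * (w2 k * g k)) * (\sum_k w1 k * g k)
       - (\sum_k y k * (w1 k * g k)) * (\sum_k w2 k * g k)).
  have T_E k l : T k l =
      (y k * (w2 k * g k) * (w1 l * g l) - y k * (w1 k * g k) * (w2 l * g l))
    + (y l * (w2 l * g l) * (w1 k * g k) - y l * (w1 l * g l) * (w2 k * g k)).
    by rewrite /T; ring.
  under eq_bigr do under eq_bigr do rewrite T_E.
  under eq_bigr do rewrite big_split /=.
  rewrite big_split /= [X in _ + X]exchange_big /= -mulr2n mulr_natl.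
  congr (_ *+ 2).
  rewrite !big_distrlr /= -sumrB; apply: eq_bigr => k _.
  by rewrite sumrB.
by rewrite pmulr_rgt0// subr_gt0.
Qed.

Lemma ltn_homo_inj (R : numDomainType) N (y : nat -> R) :
  {in gtn N &, {homo y : k l / (k < l)%N >-> k < l}} -> {in gtn N &, injective y}.
Proof.
move=> y_lt k l kN lN ykl; have [kl|lk|//] := ltngtP k l.
  by have := y_lt _ _ kN lN kl; rewrite ykl ltxx.
by have := y_lt _ _ lN kN lk; rewrite ykl ltxx.
Qed.

(** A nonzero [f] of degree at most N - 2 vanishes at no more than N - 2 of the N distinct nodes.
    Two surviving nodes are what strictness in [chebyshev_sum_lt] requires. *)
Lemma two_nonroots (R : idomainType) N (y : nat -> R) (f : {poly R}) :
  {in gtn N &, injective y} -> f != 0 -> (size f < N)%N ->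
  exists k l : 'I_N, [/\ (k < l)%N, f.[y k] != 0 & f.[y l] != 0].
Proof.
move=> y_inj f0 size_f.
pose r := [seq x <- iota 0 N | ~~ root f (y x)].
have : (1 < size r)%N.
  pose Z := [seq y x | x <- [seq x <- iota 0 N | root f (y x)]].
  have size_Z : (size Z < size f)%N.
    apply: max_poly_roots => //.
      by apply/allP => _ /mapP[x + ->]; rewrite mem_filter => /andP[].
    rewrite map_inj_in_uniq ?filter_uniq ?iota_uniq// => x x'.
    rewrite !mem_filter !mem_iota !add0n /= => /andP[_ xN] /andP[_ x'N].
    exact: y_inj.
  have : (count (fun x => root f (y x)) (iota 0 N) + size r)%N = N.
    by rewrite size_filter -[RHS](size_iota 0 N); apply: count_predC.
  by move: size_Z; rewrite size_map size_filter; lia.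
have : sorted ltn r by rewrite sorted_filter ?iota_ltn_sorted//; apply: ltn_trans.
have : {subset r <= [pred x | (x < N)%N && ~~ root f (y x)]}.
  by move=> x; rewrite mem_filter mem_iota add0n /= andbC inE.
case: r => [|k [|l r]]// rP /andP[kl _] _.
have /andP[kN fk] : k \in [pred x | (x < N)%N && ~~ root f (y x)].
  by apply: rP; rewrite mem_head.
have /andP[lN fl] : l \in [pred x | (x < N)%N && ~~ root f (y x)].
  by apply: rP; rewrite !inE eqxx orbT.
by exists (Ordinal kN), (Ordinal lN).
Qed.

(* The polynomial [f] of the proof spans the intersection of the two subspaces
   used in the Courant-Fischer argument: that of the eigenvalues at least s_i
   for w1 and that of the eigenvalues at most t_i for w2. *)
Lemma orthogonal_roots_lt (R : realFieldType) N n (y w1 w2 : nat -> R) (s t : seq R) i :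
  (n < N)%N ->
  {in gtn N &, {homo y : k l / (k < l)%N >-> k < l}} ->
  (forall x, (x < N)%N -> 0 < w1 x) -> (forall x, (x < N)%N -> 0 < w2 x) ->
  (forall k l, (k < l < N)%N -> w1 l * w2 k < w1 k * w2 l) ->
  sorted <%R s -> sorted <%R t -> size s = n -> size t = n ->
  orthogonal_below N w1 y n (\prod_(z <- s) ('X - z%:P)) ->
  orthogonal_below N w2 y n (\prod_(z <- t) ('X - z%:P)) ->
  (i < n)%N -> s`_i < t`_i.
Proof.
move=> nN y_lt w1_gt0 w2_gt0 w_lt s_lt t_lt size_s size_t orth_s orth_t i_n.
rewrite ltNge; apply/negP => ts.
pose f := (\prod_(z <- take i s) ('X - z%:P)) * (\prod_(z <- drop i.+1 t) ('X - z%:P)).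
have size_f : size f = n.
  rewrite size_Mmonic ?monic_neq0 ?monic_prod_XsubC// !size_prod_XsubC.
  by rewrite size_takel ?size_s 1?ltnW// size_drop size_t; lia.
have f_neq0 : f != 0 by rewrite -size_poly_eq0 size_f; lia.
(* In [gauss_sign], [take i s] supplies [h] and the n - 1 - i factors from [t] supply [u]; the
   remaining roots [drop i s] are those where X - s_i is nonnegative. For [pos2] the two factors of
   [f] exchange roles and the remaining roots are [take i.+1 t]. *)
have pos1 : 0 <= nodesum N w1 y (('X - (s`_i)%:P) * f ^+ 2).
  apply: (@gauss_sign _ N n w1 y _ _ _ orth_s _ _ (drop i s)).
  - by move=> x xN; rewrite ltW// w1_gt0.
  - by rewrite size_prod_XsubC size_s.
  - by rewrite size_XsubC.
  - by rewrite drop_uniq ?lt_sorted_uniq.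
  - by rewrite -big_cat cat_take_drop.
  - by rewrite size_prod_XsubC !size_drop size_s size_t; lia.
  move=> z /(nthP 0)[k]; rewrite size_drop nth_drop size_s => ki <-.
  by rewrite hornerXsubC subr_ge0 lt_sorted_leq_nth// ?inE ?size_s; lia.
have pos2 : 0 <= nodesum N w2 y (((t`_i)%:P - 'X) * f ^+ 2).
  rewrite /f [X in X ^+ 2]mulrC.
  apply: (@gauss_sign _ N n w2 y _ _ _ orth_t _ _ (take i.+1 t)).
  - by move=> x xN; rewrite ltW// w2_gt0.
  - by rewrite size_prod_XsubC size_t.
  - by rewrite -opprB size_polyN size_XsubC.
  - by rewrite take_uniq ?lt_sorted_uniq.
  - by rewrite mulrC -big_cat cat_take_drop.
  - by rewrite size_prod_XsubC !size_takel// ?size_s ?size_t//; lia.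
  move=> z /(nthP 0)[k]; rewrite size_takel ?size_t// => ki.
  rewrite nth_take// => <-.
  by rewrite hornerD hornerN hornerC hornerX subr_ge0 lt_sorted_leq_nth// ?inE ?size_t; lia.
have y_inj := ltn_homo_inj y_lt.
have [k [l [kl fk fl]]] : exists k l : 'I_N, [/\ (k < l)%N, f.[y k] != 0 & f.[y l] != 0].
  by apply: two_nonroots; rewrite ?size_f.
(* Centring at t_i fixes the signs: if t_i <= s_i, then [T w1] is nonnegative and [T w2]
   nonpositive, against the strict inequality of [chebyshev_sum_lt] for the values [y x - c]. *)
clearbody f; pose c := t`_i.
pose S (w : nat -> R) := \sum_(x < N) w x * f.[y x] ^+ 2.
pose T (w : nat -> R) := \sum_(x < N) (y x - c) * (w x * f.[y x] ^+ 2).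
have S_ge0 (w : nat -> R) : (forall x, (x < N)%N -> 0 < w x) -> 0 <= S w.
  by move=> w_gt0; rewrite sumr_ge0// => x _; rewrite mulr_ge0 ?sqr_ge0// ltW ?w_gt0.
have T1 : 0 <= T w1.
  have -> : T w1 = nodesum N w1 y (('X - (s`_i)%:P) * f ^+ 2) + (s`_i - c) * S w1.
    rewrite mulr_sumr -big_split; apply: eq_bigr => x _ /=.
    by rewrite hornerM hornerD hornerN hornerX hornerC horner_exp; ring.
  by rewrite addr_ge0 ?mulr_ge0 ?subr_ge0 ?S_ge0.
have T2 : T w2 <= 0.
  rewrite -oppr_ge0; apply: le_trans pos2 _; rewrite le_eqVlt; apply/orP; left.
  rewrite -sumrN; apply/eqP/eq_bigr => x _.
  by rewrite hornerM hornerD hornerN hornerX hornerC horner_exp /c; ring.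
have : T w1 * S w2 < T w2 * S w1.
  apply: (chebyshev_sum_lt (i := k) (j := l)) => //.
  - by move=> k' l' kl' /=; rewrite ltrD2r y_lt ?inE.
  - by move=> k' l' kl'; rewrite w_lt// kl' /=.
  - by move=> x; rewrite sqr_ge0.
  - by rewrite exprn_even_gt0.
  - by rewrite exprn_even_gt0.
apply/negP; rewrite -leNgt (@le_trans _ _ 0)//.
  by rewrite mulr_le0_ge0 ?S_ge0.
by rewrite mulr_ge0 ?S_ge0.
Qed.

(** * Real and simple zeros of orthogonal polynomials *)

(** The list [s] consists of the real roots of odd multiplicity, where [p] changes sign; [h] keeps a
    constant sign, which [e] records. *)
Lemma simple_factorization (R : rcfType) (p : {poly R}) : p != 0 ->
  exists (s : seq R) (h : {poly R}) (e : R), [/\ uniq s, e != 0,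
    p = h * \prod_(z <- s) ('X - z%:P) & forall x, 0 <= e * h.[x]].
Proof.
have [m] := ubnP (size p); elim: m p => // m IHm p size_p p0.
have mem_rootsR x : (x \in rootsR p) = root p x by rewrite -roots_on_rootsR.
case: (rootsR p) mem_rootsR => [noroot|z r /(_ z)].
  exists [::], p, p.[0]; rewrite big_nil mulr1; split=> // [|x].
    by rewrite -rootE -noroot.
  rewrite leNgt; apply/negP => p0x.
  have [x_ge0|x_lt0] := leP 0 x.
    by have [r _] := poly_ivtoo x_ge0 p0x; rewrite -noroot.
  by rewrite mulrC in p0x; have [r _] := poly_ivtoo (ltW x_lt0) p0x; rewrite -noroot.
rewrite mem_head => /esym/factor_theorem[p' defp].
have p'0 : p' != 0 by apply: contraNneq p0 => p'0; rewrite defp p'0 mul0r.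
have size_p' : (size p' < m)%N.
  by move: size_p; rewrite defp size_Mmonic ?monicXsubC// size_XsubC addn2.
have [s [h [e [s_uniq e0 defp' h_ge0]]]] := IHm p' size_p' p'0.
(* A second occurrence of [z] makes its multiplicity even: it leaves [s], and the square of X - z
   goes into [h]. *)
have [zs|zs] := boolP (z \in s).
  exists (rem z s), (h * ('X - z%:P) ^+ 2), e; split=> //; first exact: rem_uniq.
    by rewrite defp defp' (perm_big _ (perm_to_rem zs)) big_cons /=; ring.
  by move=> x; rewrite hornerM horner_exp mulrA mulr_ge0 ?sqr_ge0.
exists (z :: s), h, e; split=> //; first by rewrite /= zs.
by rewrite defp defp' big_cons /=; ring.
Qed.

(** With fewer than n sign changes, [p] could be tested against the product [m] of its odd-order
    factors. The resulting sum has terms of constant sign and vanishes, so [p] would be zero at all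
    N nodes, more than its degree allows. *)
Lemma orthogonal_rootsR (R : rcfType) N n (w y : nat -> R) (p : {poly R}) :
  (n < N)%N -> {in gtn N &, injective y} -> (forall x, (x < N)%N -> 0 < w x) ->
  size p = n.+1 -> orthogonal_below N w y n p ->
  size (rootsR p) = n /\ p = lead_coef p *: \prod_(z <- rootsR p) ('X - z%:P).
Proof.
move=> nN y_inj w_gt0 size_p orth_p.
have p0 : p != 0 by rewrite -size_poly_eq0 size_p.
have [s [h [e [s_uniq e0 defp h_ge0]]]] := simple_factorization p0.
set m := \prod_(z <- s) _ in defp.
have size_m : size m = (size s).+1 by rewrite size_prod_XsubC.
have h0 : h != 0 by apply: contraNneq p0 => h0; rewrite defp h0 mul0r.
have size_p_hm : size p = (size h + size s)%N.
  by rewrite defp size_Mmonic ?monic_prod_XsubC// size_m addnS.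
have size_h_gt0 : (0 < size h)%N by rewrite size_poly_gt0.
have size_s : size s = n.
  apply/eqP; rewrite eqn_leq -ltnS -size_p size_p_hm -add1n leq_add2r size_h_gt0 /=.
  rewrite leqNgt; apply/negP => s_lt_n.
  have sum0 : \sum_(x < N) w x * (e * h.[y x]) * m.[y x] ^+ 2 = 0.
    transitivity (e * nodesum N w y (p * m)); last by rewrite orth_p ?mulr0 ?size_m.
    rewrite mulr_sumr; apply: eq_bigr => x _; rewrite defp !hornerM; ring.
  have term_ge0 (x : 'I_N) : true -> 0 <= w x * (e * h.[y x]) * m.[y x] ^+ 2.
    by move=> _; rewrite mulr_ge0 ?sqr_ge0// mulr_ge0// ltW ?w_gt0.
  have p_y0 (x : 'I_N) : root p (y x).
    have /eqP := psumr_eq0P term_ge0 sum0 isT (i := x).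
    rewrite !mulf_eq0 gt_eqF ?w_gt0// (negPf e0) /= orbb.
    by rewrite rootE defp hornerM mulf_eq0.
  have : (size [seq y x | x <- iota 0 N] < size p)%N.
    apply: max_poly_roots => //.
      apply/allP => _ /mapP[x + ->]; rewrite mem_iota /= => xN.
      exact: (p_y0 (Ordinal xN)).
    rewrite map_inj_in_uniq ?iota_uniq// => x x'.
    rewrite !mem_iota !add0n /=; exact: y_inj.
  by rewrite size_map size_iota size_p ltnS leqNgt nN.
have size_h : size h = 1%N by move: size_p_hm; rewrite size_p size_s; lia.
have /size_poly1P[c c0 defh] : size h == 1%N by rewrite size_h.
have perm_s : perm_eq s (rootsR p).
  apply: uniq_perm => // [|x]; first by rewrite lt_sorted_uniq ?sorted_roots.
  by rewrite -roots_on_rootsR// defp defh mul_polyC rootZ// root_prod_XsubC.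
split; first by rewrite -(perm_size perm_s).
rewrite -(perm_big _ perm_s) -/m {1}defp defh mul_polyC.
by congr (_ *: _); rewrite defp lead_coef_Mmonic ?monic_prod_XsubC// defh lead_coefC.
Qed.

Lemma orthogonal_rootsR_lt (R : rcfType) N n (y w1 w2 : nat -> R) (p1 p2 : {poly R}) i :
  (n < N)%N ->
  {in gtn N &, {homo y : k l / (k < l)%N >-> k < l}} ->
  (forall x, (x < N)%N -> 0 < w1 x) -> (forall x, (x < N)%N -> 0 < w2 x) ->
  (forall k l, (k < l < N)%N -> w1 l * w2 k < w1 k * w2 l) ->
  size p1 = n.+1 -> size p2 = n.+1 ->
  orthogonal_below N w1 y n p1 -> orthogonal_below N w2 y n p2 ->
  (i < n)%N -> (rootsR p1)`_i < (rootsR p2)`_i.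
Proof.
move=> nN y_lt w1_gt0 w2_gt0 w_lt size1 size2 orth1 orth2.
have y_inj := ltn_homo_inj y_lt.
have orth_prod (w : nat -> R) (p : {poly R}) :
    (forall x, (x < N)%N -> 0 < w x) -> size p = n.+1 -> orthogonal_below N w y n p ->
    size (rootsR p) = n /\ orthogonal_below N w y n (\prod_(z <- rootsR p) ('X - z%:P)).
  move=> w_gt0 sizep orthp.
  have [? defp] := orthogonal_rootsR nN y_inj w_gt0 sizep orthp; split=> // f sizef.
  have lc0 : lead_coef p != 0 by rewrite lead_coef_eq0 -size_poly_eq0 sizep.
  apply: (mulfI lc0); rewrite mulr0 -nodesumZ scalerAl -defp.
  exact: orthp.
have [sz1 o1] := orth_prod _ _ w1_gt0 size1 orth1.
have [sz2 o2] := orth_prod _ _ w2_gt0 size2 orth2.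
by apply: (orthogonal_roots_lt nN y_lt w1_gt0 w2_gt0 w_lt) => //; exact: sorted_roots.
Qed.

(** * Shifted factorials and summation by parts *)

Lemma qpochS (R : realType) (q u : R) k :
  qpoch q u k.+1 = qpoch q u k * (1 - u * q ^+ k).
Proof. by rewrite /qpoch big_ord_recr. Qed.

Lemma qpochSl (R : realType) (q u : R) k :
  qpoch q u k.+1 = (1 - u) * qpoch q (u * q) k.
Proof.
rewrite /qpoch big_ord_recl mulr1; congr (_ * _).
by apply: eq_bigr => j _; rewrite lift0 exprS mulrA.
Qed.

Lemma qpoch_neq0 (R : realType) (q u : R) k :
  (forall j, (j < k)%N -> u * q ^+ j != 1) -> qpoch q u k != 0.
Proof. by move=> u_neq; apply/prodf_neq0 => j _; rewrite subr_eq0 eq_sym u_neq. Qed.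

(** A discrete E f', attached to the edge that ends at [x]. Its increments form a second-order
    difference operator in self-adjoint form. *)
Definition flux {R : pzRingType} (E f : nat -> R) (x : nat) : R :=
  if x is x'.+1 then E x' * (f x - f x') else 0.

(** Summation by parts: the boundary term at 0 is zero by the definition of [flux], and the
    remaining sum is symmetric in [f] and [g]. *)
Lemma sum_flux (R : comPzRingType) (E f g : nat -> R) N :
  \sum_(x < N) (flux E f x.+1 - flux E f x) * g x =
  flux E f N * g N - \sum_(x < N) E x * (f x.+1 - f x) * (g x.+1 - g x).
Proof.
elim: N => [|N IHN]; first by rewrite !big_ord0 /= mul0r subrr.
by rewrite !big_ord_recr /= IHN; case: N {IHN} => [|N] /=; ring.
Qed.

(** * The q-Racah weight, its difference operator, and orthogonality *)

Section QRacahOrthogonality.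
Variables (R : realType) (q d b c : R) (N : nat).
Hypotheses (q_gt0 : 0 < q) (q_lt1 : q < 1).
Hypotheses (d_gt0 : 0 < d) (d_lt1 : d < 1) (d_lt_b : d < b).
Hypotheses (bq_lt1 : b * q < 1) (c_gt0 : 0 < c) (cq_lt1 : c * q < 1).

(* Here d, b, c stand for q^(2a), q^beta, q^alpha, and q ^+ x for q^(s-a). *)
Definition qRacah_ratio (x : nat) : R :=
  (1 - b * q * q ^+ x) * (1 - d * c * q ^+ N * q ^+ x)
    * (q * q ^+ x - q ^+ N) * (1 - d * q ^+ x) /
  (q * (1 - q * q ^+ x) * (1 - d * q ^+ N * q ^+ x)
    * (q * q ^+ x - c * q ^+ N) * (b - d * q ^+ x)).

(** The factor before the product involves neither [b] nor [c], so weights for different parameters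
    compare through [qRacah_ratio] alone. *)
Definition qRacah_weight (x : nat) : R :=
  (1 - d * (q ^+ x) ^+ 2) * \prod_(j < x) qRacah_ratio j.

(* The coefficient of y(x+1) - y(x) in the difference operator, multiplied by the
   weight; it vanishes at the last node, and [flux] is 0 at the first one, which
   avoids the factor 1 - q^(2a-1) of the usual form of the operator (zero for
   a = 1/2). *)
Definition qRacah_edge (x : nat) : R :=
  (\prod_(j < x) qRacah_ratio j) * ((1 - b * q * q ^+ x) * (1 - d * c * q ^+ N * q ^+ x)
    * (1 - q * q ^+ x / q ^+ N) * (1 - d * q ^+ x)) / (1 - d * q * (q ^+ x) ^+ 2).

(* The values of [qRacah_basis q a k] at the nodes. *)
Definition qRacah_phi (k x : nat) : R :=
  qpoch q (q ^+ x)^-1 k * qpoch q (d * q ^+ x) k.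

Definition qRacah_eigenvalue (k : nat) : R :=
  (1 - q ^+ k) * (1 - b * c * q * q ^+ k) / q ^+ k.

(* Indexed by the target: the coefficient of phi_k in the image of phi_(k+1). *)
Definition qRacah_lower (k : nat) : R :=
  - ((1 - d * c * q ^+ N * q ^+ k) * (1 - b * q * q ^+ k)
     * (1 - q * q ^+ k / q ^+ N) * (1 - q * q ^+ k)) / (q * q ^+ k).

Let qX_gt0 k : 0 < q ^+ k. Proof. exact: exprn_gt0. Qed.
Let qX_le1 k : q ^+ k <= 1. Proof. by rewrite exprn_ile1// ltW. Qed.
Let qXS_lt k l : (k < l)%N -> q ^+ l < q ^+ k.
Proof. by move=> kl; rewrite ltr_iXn2l. Qed.
Let qX_neq0 k : q ^+ k != 0. Proof. by rewrite gt_eqF. Qed.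
Let q_neq0 : q != 0. Proof. by rewrite gt_eqF. Qed.

Let dq_lt1 k : d * q ^+ k < 1.
Proof. by rewrite (le_lt_trans _ d_lt1)// ler_piMr// ltW. Qed.

Let bq_ltX k : b * q * q ^+ k < 1.
Proof.
by rewrite (le_lt_trans _ bq_lt1)// ler_piMr// mulr_ge0 ?ltW// (lt_trans d_gt0).
Qed.

Let cqN_lt k : (k.+1 < N)%N -> c * q ^+ N < q * q ^+ k.
Proof.
case: N => // M; rewrite ltnS => kM; rewrite -exprS exprS mulrA.
apply: (@lt_le_trans _ _ (q ^+ M)); first by rewrite gtr_pMl.
by rewrite ler_wiXn2l// ltW.
Qed.

Let dcqN_lt1 k : (0 < N)%N -> d * c * q ^+ N * q ^+ k < 1.
Proof.
case: N => // M _; rewrite exprS.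
have -> : d * c * (q * q ^+ M) * q ^+ k = (c * q) * (d * q ^+ (M + k)).
  by rewrite exprD; ring.
by apply: mulr_ilt1 => //; rewrite ltW ?mulr_gt0.
Qed.

Lemma qRacah_factors_gt0 x : (x.+1 < N)%N ->
  [/\ 0 < 1 - b * q * q ^+ x, 0 < 1 - d * c * q ^+ N * q ^+ x,
      0 < q * q ^+ x - q ^+ N & 0 < 1 - d * q ^+ x] /\
  [/\ 0 < 1 - q * q ^+ x, 0 < 1 - d * q ^+ N * q ^+ x,
      0 < q * q ^+ x - c * q ^+ N, 0 < b - d * q ^+ x & 0 < 1 - d * q * (q ^+ x) ^+ 2].
Proof.
move=> xN; do !split; rewrite subr_gt0//.
- by rewrite dcqN_lt1//; lia.
- by rewrite -exprS qXS_lt.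
- by rewrite -exprS exprn_ilt1// ltW.
- by rewrite -mulrA -exprD.
- exact: cqN_lt.
- by rewrite (le_lt_trans _ d_lt_b)// ler_piMr// ltW.
by rewrite -mulrA -exprM -exprS.
Qed.

Lemma qRacah_ratio_gt0 x : (x.+1 < N)%N -> 0 < qRacah_ratio x.
Proof.
move=> /qRacah_factors_gt0[[h1 h2 h3 h4] [h5 h6 h7 h8 _]].
by rewrite /qRacah_ratio divr_gt0// !mulr_gt0.
Qed.

Lemma qRacah_weight_gt0 x : (x < N)%N -> 0 < qRacah_weight x.
Proof.
move=> xN; rewrite /qRacah_weight mulr_gt0//.
  by rewrite subr_gt0 -exprM.
by apply: prodr_gt0 => j _; apply: qRacah_ratio_gt0; have := ltn_ord j; lia.
Qed.

Lemma qRacah_edge_last : (0 < N)%N -> qRacah_edge N.-1 = 0.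
Proof.
by move=> N0; rewrite /qRacah_edge -exprS prednK// divff// subrr !(mulr0, mul0r).
Qed.

(** The same edge coefficient seen from its right endpoint x + 1: the factor [qRacah_ratio x] is
    absorbed into the product, as in a detailed balance relation. *)
Lemma qRacah_edgeE x : (x.+1 < N)%N -> qRacah_edge x =
  (\prod_(j < x.+1) qRacah_ratio j) * (q * (1 - q * q ^+ x) * (1 - d * q ^+ N * q ^+ x)
    * (c - q * q ^+ x / q ^+ N) * (b - d * q ^+ x)) / (1 - d * q * (q ^+ x) ^+ 2).
Proof.
move=> /qRacah_factors_gt0[_ [/lt0r_neq0 h1 /lt0r_neq0 h2 /lt0r_neq0 h3 /lt0r_neq0 h4]].
move=> /lt0r_neq0 h5; rewrite big_ord_recr /= /qRacah_edge.
move: (\prod_(j < x) qRacah_ratio j) => u; rewrite /qRacah_ratio.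
have := qX_neq0 N; move: h1 h2 h3 h4 h5.
move: (q ^+ N) (q ^+ x) => M Q h1 h2 h3 h4 h5 M0.
field.
by rewrite M0 h1 h2 h3 h4 h5.
Qed.

(** The shift from x to x + 1 moves each shifted factorial by one factor, so both values share the
    last product and differ only in two linear factors. The factor 1 - d q^(2x+1) cancels the
    denominator of [qRacah_edge]. *)
Lemma qRacah_phi_diff k x : qRacah_phi k.+1 x.+1 - qRacah_phi k.+1 x =
  - (1 - q * q ^+ k) * (1 - d * q * (q ^+ x) ^+ 2) / (q * q ^+ x)
  * (qpoch q (q ^+ x)^-1 k * qpoch q (d * q * q ^+ x) k).
Proof.
rewrite /qRacah_phi qpochSl [qpoch q (d * q ^+ x.+1) _]qpochS.
rewrite [qpoch q (q ^+ x)^-1 k.+1]qpochS [qpoch q (d * q ^+ x) _]qpochSl.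
have -> : (q ^+ x.+1)^-1 * q = (q ^+ x)^-1 by rewrite exprS invfM mulrAC mulVf ?mul1r.
have -> : d * q ^+ x.+1 = d * q * q ^+ x by rewrite exprS mulrA.
have -> : d * q ^+ x * q = d * q * q ^+ x by rewrite mulrAC.
rewrite [q ^+ x.+1]exprS; have := qX_neq0 x; move: (q ^+ x) (q ^+ k) => Q K Q0.
by field; rewrite Q0 q_neq0.
Qed.

(** This lemma treats the edge to the right of [x] and [qRacah_flux] the edge to its left; both
    bring out the same product of ratios and the same [qRacah_phi k x]. *)
Lemma qRacah_fluxS k x : flux qRacah_edge (qRacah_phi k.+1) x.+1 =
  (\prod_(j < x) qRacah_ratio j) * qRacah_phi k x
  * ((1 - b * q * q ^+ x) * (1 - d * c * q ^+ N * q ^+ x) * (1 - q * q ^+ x / q ^+ N)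
     * (1 - d * q ^+ x * q ^+ k) * - (1 - q * q ^+ k) / (q * q ^+ x)).
Proof.
rewrite /flux qRacah_phi_diff /qRacah_edge /qRacah_phi.
have h5 : 1 - d * q * (q ^+ x) ^+ 2 != 0.
  by rewrite subr_eq0 gt_eqF// -mulrA -exprM -exprS.
have := qpochSl q (d * q ^+ x) k; rewrite qpochS [d * _ * q]mulrAC.
move: (qpoch q (q ^+ x)^-1 k) (qpoch q (d * q ^+ x) k) (qpoch q (d * q * q ^+ x) k).
have := qX_neq0 x; have := qX_neq0 N.
move: h5; move: (\prod_(j < x) qRacah_ratio j) (q ^+ N) (q ^+ x) (q ^+ k) => u M Q K.
move=> h5 M0 Q0 p1 p2 p3 E.
have -> : u * (p1 * p2) * ((1 - b * q * Q) * (1 - d * c * M * Q) * (1 - q * Q / M)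
     * (1 - d * Q * K) * - (1 - q * K) / (q * Q)) =
  u * p1 * (p2 * (1 - d * Q * K)) * ((1 - b * q * Q) * (1 - d * c * M * Q)
     * (1 - q * Q / M) * - (1 - q * K) / (q * Q)) by ring.
by rewrite E; field; rewrite h5 M0 Q0 q_neq0.
Qed.

Lemma qRacah_flux k x : (x < N)%N -> flux qRacah_edge (qRacah_phi k.+1) x =
  (\prod_(j < x) qRacah_ratio j) * qRacah_phi k x
  * ((q - d * q ^+ N * q ^+ x) * (c - q ^+ x / q ^+ N) * (b * q - d * q ^+ x)
     * (1 - q ^+ k / q ^+ x) * (1 - q * q ^+ k) / q).
Proof.
case: x => [|x] xN.
  rewrite /= /qRacah_phi expr0 invr1 !mulr1.
  (* As (1; q)_(k+1) = 0, either [qpoch q 1 k] or 1 - q^k is zero; so the right-hand side vanishes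
     at the first node, like the flux. *)
  have := qpochSl q 1 k; rewrite subrr mul0r qpochS mul1r => /eqP.
  rewrite mulf_eq0 => /orP[]/eqP->; by rewrite !(mul0r, mulr0).
rewrite /flux qRacah_phi_diff qRacah_edgeE// /qRacah_phi.
have h5 : 1 - d * q * (q ^+ x) ^+ 2 != 0.
  by rewrite subr_eq0 gt_eqF// -mulrA -exprM -exprS.
have := qpochSl q (q ^+ x.+1)^-1 k; rewrite qpochS.
have -> : (q ^+ x.+1)^-1 * q = (q ^+ x)^-1 by rewrite exprS invfM mulrAC mulVf ?mul1r.
have -> : d * q ^+ x.+1 = d * q * q ^+ x by rewrite exprS mulrA.
move: (qpoch q (q ^+ x)^-1 k) (qpoch q (q ^+ x.+1)^-1 k) (qpoch q (d * q * q ^+ x) k).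
have := qX_neq0 x; have := qX_neq0 N.
rewrite ![q ^+ x.+1]exprS.
move: h5; move: (\prod_(j < x.+1) qRacah_ratio j) (q ^+ N) (q ^+ x) (q ^+ k) => u M Q K.
move=> h5 M0 Q0 p1 p2 p3 E.
have -> : u * (p2 * p3) * ((q - d * M * (q * Q)) * (c - q * Q / M) * (b * q - d * q * Q)
     * (1 - K / (q * Q)) * (1 - q * K) / q) =
  u * p3 * (p2 * (1 - (q * Q)^-1 * K)) * ((q - d * M * (q * Q)) * (c - q * Q / M)
     * (b * q - d * q * Q) * (1 - q * K) / q) by ring.
by rewrite E; field; rewrite h5 M0 Q0 q_neq0.
Qed.

(** Once the common factor of the two fluxes is removed, a rational identity in q^k, q^x and q^N
    remains. The operator is thus bidiagonal in the basis phi_k. *)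
Lemma qRacah_flux_eigen k x : (x < N)%N ->
  flux qRacah_edge (qRacah_phi k.+1) x.+1 - flux qRacah_edge (qRacah_phi k.+1) x =
  qRacah_weight x * (qRacah_eigenvalue k.+1 * qRacah_phi k.+1 x
    + qRacah_lower k * qRacah_phi k x).
Proof.
move=> xN; rewrite qRacah_fluxS qRacah_flux//.
have -> : qRacah_phi k.+1 x =
    qRacah_phi k x * ((1 - q ^+ k / q ^+ x) * (1 - d * q ^+ x * q ^+ k)).
  by rewrite /qRacah_phi !qpochS [_^-1 * _]mulrC; ring.
rewrite /qRacah_weight /qRacah_eigenvalue /qRacah_lower [q ^+ k.+1]exprS.
have := qX_neq0 x; have := qX_neq0 N; have := qX_neq0 k.
move: (\prod_(j < x) qRacah_ratio j) (qRacah_phi k x) => u p.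
move: (q ^+ N) (q ^+ x) (q ^+ k) => M Q K K0 M0 Q0.
by field; rewrite K0 M0 Q0 q_neq0.
Qed.

Definition qRacah_eigencoef (n k : nat) : R :=
  qpoch q (q ^+ n)^-1 k * qpoch q (b * c * q * q ^+ n) k /
  (qpoch q (d * c * q ^+ N) k * qpoch q (b * q) k * qpoch q (q / q ^+ N) k
   * qpoch q q k) * q ^+ k.

(** This recursion is the comparison of the coefficients of phi_k in the eigenvalue equation for the
    sum of the C_k phi_k. *)
Lemma qRacah_eigencoefS n k : (k.+1 < N)%N ->
  qRacah_eigencoef n k.+1 * qRacah_lower k =
  (qRacah_eigenvalue n - qRacah_eigenvalue k) * qRacah_eigencoef n k.
Proof.
move=> kN; rewrite /qRacah_eigencoef !qpochS.
have h1 : 1 - d * c * q ^+ N * q ^+ k != 0 by rewrite subr_eq0 gt_eqF// dcqN_lt1//; lia.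
have h2 : 1 - b * q * q ^+ k != 0 by rewrite subr_eq0 gt_eqF.
have h3 : q ^+ N - q * q ^+ k != 0 by rewrite subr_eq0 -exprS lt_eqF// qXS_lt.
have h4 : 1 - q * q ^+ k != 0 by rewrite subr_eq0 -exprS gt_eqF// exprn_ilt1// ltW.
rewrite /qRacah_lower /qRacah_eigenvalue [q ^+ k.+1]exprS.
have := qX_neq0 k; have := qX_neq0 N; have := qX_neq0 n; move: h1 h2 h3 h4.
move: (qpoch q (q ^+ n)^-1 k) (qpoch q (b * c * q * q ^+ n) k).
move: (qpoch q (d * c * q ^+ N) k) (qpoch q (b * q) k) (qpoch q (q / q ^+ N) k).
move: (qpoch q q k) (q ^+ n) (q ^+ N) (q ^+ k).
move=> p6 Qn M K p3 p4 p5 p1 p2 h1 h2 h3 h4 n0 M0 K0.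
set C := p1 * p2 / _ * K.
transitivity (C * ((1 - Qn^-1 * K) * (1 - b * c * q * Qn * K) * q
    / ((1 - d * c * M * K) * (1 - b * q * K) * (1 - q / M * K) * (1 - q * K))
  * (- ((1 - d * c * M * K) * (1 - b * q * K) * (1 - q * K / M) * (1 - q * K)) / (q * K)))).
  by rewrite /C !invfM; ring.
by field; rewrite K0 M0 n0 q_neq0 h1 h2 h3 h4.
Qed.

Lemma qRacah_eigencoef_neq0 n : (0 < n < N)%N -> qRacah_eigencoef n n != 0.
Proof.
move=> /andP[n0 nN].
have b_gt0 : 0 < b by exact: lt_trans d_lt_b.
rewrite /qRacah_eigencoef !mulf_neq0 ?invr_neq0 ?mulf_neq0// qpoch_neq0// => j jn.
- apply: contraTneq (qXS_lt jn).
  by move/(canRL (mulKf (invr_neq0 (qX_neq0 n)))); rewrite invrK mulr1 => ->; rewrite ltxx.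
(* One factor q of q^n goes to [c], because the hypotheses bound [b * q] and [c * q] by 1, not [b]
   and [c]. *)
- have -> : b * c * q * q ^+ n * q ^+ j = (b * q) * (c * q * q ^+ (n.-1 + j)).
    by rewrite -{1}(prednK n0) exprS exprD; ring.
  rewrite lt_eqF// mulr_ilt1// ?mulr_ge0 ?ltW//.
  by rewrite (le_lt_trans _ cq_lt1)// ler_piMr// ltW ?mulr_gt0.
- by rewrite lt_eqF// dcqN_lt1//; lia.
- by rewrite lt_eqF.
- rewrite mulrAC -exprS; apply: contraTneq (qXS_lt (leq_ltn_trans jn nN)).
  by move/(canRL (divfK (qX_neq0 N))); rewrite mul1r => ->; rewrite ltxx.
by rewrite -exprS lt_eqF// exprn_ilt1// ltW.
Qed.

Variables (y : nat -> R) (B : nat -> {poly R}).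
Hypothesis B_phi : forall k x, (B k).[y x] = qRacah_phi k x.

Definition qRacah_sum (n : nat) : {poly R} := \sum_(k < n.+1) qRacah_eigencoef n k *: B k.

Lemma flux_phi0 x : flux qRacah_edge (qRacah_phi 0) x = 0.
Proof. by case: x => //= x; rewrite /qRacah_phi /qpoch !big_ord0 subrr mulr0. Qed.

Lemma qRacah_sum_eigen n x : (n < N)%N -> (x < N)%N ->
  flux qRacah_edge (fun x => (qRacah_sum n).[y x]) x.+1
   - flux qRacah_edge (fun x => (qRacah_sum n).[y x]) x =
  qRacah_weight x * qRacah_eigenvalue n * (qRacah_sum n).[y x].
Proof.
move=> nN xN.
have fluxE x' : flux qRacah_edge (fun x => (qRacah_sum n).[y x]) x' =
    \sum_(k < n.+1) qRacah_eigencoef n k * flux qRacah_edge (qRacah_phi k) x'.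
  case: x' => [|x'] /=; first by rewrite big1// => k _; rewrite mulr0.
  rewrite !horner_sum -sumrB mulr_sumr; apply: eq_bigr => k _.
  by rewrite !hornerZ !B_phi; ring.
have eigen0 : qRacah_eigenvalue 0 = 0 by rewrite /qRacah_eigenvalue expr0 subrr !mul0r.
pose C := qRacah_eigencoef n; pose lam := qRacah_eigenvalue.
pose phi k := qRacah_phi k x; pose S := \sum_(k < n.+1) C k * lam k * phi k.
(* The shifted sum reaches the full [S] because lam 0 = 0; in [S2] the term k = n drops out as lam n
   - lam k vanishes there. The two copies of [S] then cancel. *)
have S1 : \sum_(k < n) C k.+1 * lam k.+1 * phi k.+1 = S.
  by rewrite /S big_ord_recl /lam eigen0 mulr0 mul0r add0r.
have S2 : \sum_(k < n) C k.+1 * qRacah_lower k * phi k =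
    lam n * (\sum_(k < n.+1) C k * phi k) - S.
  rewrite /S mulr_sumr -sumrB [RHS]big_ord_recr /= [C n * lam n]mulrC mulrA subrr addr0.
  apply: eq_bigr => k _; rewrite qRacah_eigencoefS; last by have := ltn_ord k; lia.
  by rewrite -/(C k) -/(lam n) -/(lam k); ring.
have Ex : (qRacah_sum n).[y x] = \sum_(k < n.+1) C k * phi k.
  by rewrite horner_sum; apply: eq_bigr => k _; rewrite hornerZ B_phi.
rewrite !fluxE -sumrB big_ord_recl !flux_phi0 subrr add0r Ex -mulrA.
transitivity (qRacah_weight x * (\sum_(k < n) C k.+1 * lam k.+1 * phi k.+1
    + \sum_(k < n) C k.+1 * qRacah_lower k * phi k)); last by rewrite S1 S2 addrC subrK.
rewrite -big_split mulr_sumr; apply: eq_bigr => k _.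
by rewrite lift0 -mulrBr qRacah_flux_eigen//= /C /lam /phi; ring.
Qed.

Lemma flux_selfadjoint (f g : nat -> R) : (0 < N)%N ->
  \sum_(x < N) (flux qRacah_edge f x.+1 - flux qRacah_edge f x) * g x =
  \sum_(x < N) (flux qRacah_edge g x.+1 - flux qRacah_edge g x) * f x.
Proof.
move=> N0; rewrite !sum_flux.
have flux_last h : flux qRacah_edge h N = 0.
  by rewrite -(prednK N0) /= prednK// qRacah_edge_last// mul0r.
by rewrite !flux_last !mul0r; congr (_ - _); apply: eq_bigr => x _; rewrite mulrAC.
Qed.

Lemma qRacah_eigenvalue_inj n j : (j < n)%N ->
  qRacah_eigenvalue n - qRacah_eigenvalue j != 0.
Proof.
move=> jn; have -> : qRacah_eigenvalue n - qRacah_eigenvalue j =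
    (q ^+ j - q ^+ n) * (1 - b * c * q * (q ^+ n * q ^+ j)) / (q ^+ j * q ^+ n).
  rewrite /qRacah_eigenvalue; have := qX_neq0 j; have := qX_neq0 n.
  by move: (q ^+ n) (q ^+ j) => x z x0 z0; field; rewrite x0 z0.
rewrite !mulf_neq0 ?invr_neq0 ?mulf_neq0// subr_eq0 gt_eqF// ?qXS_lt//.
have -> : b * c * q * (q ^+ n * q ^+ j) = (b * q) * (c * q * q ^+ (n + j).-1).
  by rewrite -exprD -{1}(@prednK (n + j)) ?exprS; [ring | lia].
have b_gt0 : 0 < b by exact: lt_trans d_lt_b.
apply: mulr_ilt1; rewrite ?mulr_ge0 ?ltW//.
by rewrite (le_lt_trans _ cq_lt1)// ler_piMr// ltW ?mulr_gt0.
Qed.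

(** Self-adjointness lets the operator act on B_j instead, so (lam n - lam j) times the pairing with
    B_j is a multiple of the pairing with B_(j-1). This is zero by induction, and the eigenvalues
    differ. *)
Lemma qRacah_sum_orthogonal n j : (j < n)%N -> (n < N)%N ->
  nodesum N qRacah_weight y (qRacah_sum n * B j) = 0.
Proof.
move=> jn nN; have N0 : (0 < N)%N by lia.
have adj i : qRacah_eigenvalue n * nodesum N qRacah_weight y (qRacah_sum n * B i) =
    \sum_(x < N) (flux qRacah_edge (qRacah_phi i) x.+1 - flux qRacah_edge (qRacah_phi i) x)
      * (qRacah_sum n).[y x].
  rewrite (flux_selfadjoint _ (fun x => (qRacah_sum n).[y x]))// mulr_sumr.
  apply: eq_bigr => x _.
  by rewrite qRacah_sum_eigen// hornerM B_phi; ring.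
elim: j jn => [|j IHj] jn; apply: (mulfI (qRacah_eigenvalue_inj jn)); rewrite mulr0.
  rewrite [qRacah_eigenvalue 0]/qRacah_eigenvalue expr0 subrr !mul0r subr0 adj big1// => x _.
  rewrite [X in X * _ = _](_ : _ = 0) ?mul0r//.
  by rewrite !flux_phi0 subrr.
rewrite mulrBl adj; apply/eqP; rewrite subr_eq0; apply/eqP.
transitivity (qRacah_eigenvalue j.+1 * nodesum N qRacah_weight y (qRacah_sum n * B j.+1)
  + qRacah_lower j * nodesum N qRacah_weight y (qRacah_sum n * B j)); last first.
  by rewrite IHj ?mulr0 ?addr0//; lia.
rewrite !mulr_sumr -big_split; apply: eq_bigr => x _.
by rewrite qRacah_flux_eigen//= !hornerM !B_phi; ring.
Qed.

End QRacahOrthogonality.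

(** * Dependence of the weight on the parameters *)

(** The quotient of the second weight by the first is a product of the quotients r2 j / r1 j > 1,
    hence increasing; the common factor [v] cancels. *)
Lemma weight_ratio_lt (R : realFieldType) N (v r1 r2 : nat -> R) :
  (forall x, (x < N)%N -> 0 < v x) ->
  (forall j, (j.+1 < N)%N -> 0 < r1 j < r2 j) ->
  forall k l, (k < l < N)%N ->
  (v l * \prod_(j < l) r1 j) * (v k * \prod_(j < k) r2 j) <
  (v k * \prod_(j < k) r1 j) * (v l * \prod_(j < l) r2 j).
Proof.
move=> v_gt0 r_lt k l /andP[kl lN].
pose u (r : nat -> R) x : R := \prod_(j < x) r j.
have u_gt0 (r : nat -> R) x : (forall j, (j.+1 < N)%N -> 0 < r j) -> (x < N)%N -> 0 < u r x.
  by move=> r_gt0 xN; apply: prodr_gt0 => j _; apply: r_gt0; have := ltn_ord j; lia.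
have r1_gt0 j : (j.+1 < N)%N -> 0 < r1 j by move=> /r_lt/andP[].
have r2_gt0 j : (j.+1 < N)%N -> 0 < r2 j.
  by move=> /r_lt/andP[]; apply: lt_trans.
suff : u r1 l * u r2 k < u r1 k * u r2 l.
  move=> u_lt; rewrite mulrACA [v l * v k]mulrC [ltRHS]mulrACA ltr_pM2l//.
  by rewrite mulr_gt0 ?v_gt0// (ltn_trans kl).
elim: l kl lN => // l IHl; rewrite ltnS leq_eqVlt => kl lN.
have le_l : u r1 l * u r2 k <= u r1 k * u r2 l.
  by case/orP: kl => [/eqP->//|kl]; rewrite ltW// IHl// ltnW.
have /andP[_ r12] := r_lt l lN.
rewrite /u !big_ord_recr /= -!/(u _ _) mulrAC mulrA.
apply: (@le_lt_trans _ _ (u r1 k * u r2 l * r1 l)).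
  by rewrite ler_wpM2r// ltW ?r1_gt0.
rewrite ltr_pM2l// mulr_gt0 ?u_gt0 ?(ltnW lN)//.
by case/orP: kl lN => [/eqP->|] ; lia.
Qed.

(** Only (1 - d c M Q) / (q Q - c M) depends on c, with M = q^N and Q = q^x. Its cross-multiplied
    difference is M (c2 - c1) (1 - d q Q^2). As c = q^alpha decreases in alpha, so does the
    ratio. *)
Lemma qRacah_ratio_lt_c (R : realType) (q d b c1 c2 : R) N x :
  0 < q -> q < 1 -> 0 < d -> d < 1 -> d < b -> b * q < 1 ->
  0 < c1 -> c1 < c2 -> c2 * q < 1 -> (x.+1 < N)%N ->
  qRacah_ratio q d b c1 N x < qRacah_ratio q d b c2 N x.
Proof.
move=> q0 q1 d0 d1 db bq c10 c12 cq xN.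
have c20 : 0 < c2 by exact: lt_trans c12.
have c1q : c1 * q < 1 by rewrite (lt_trans _ cq)// ltr_pM2r.
have M0 : 0 < q ^+ N by exact: exprn_gt0.
have [[h1 _ h3 h4] [h5 h6 g1 h8 h9]] := qRacah_factors_gt0 q0 q1 d0 d1 db bq c10 c1q xN.
have [_ [_ _ g2 _ _]] := qRacah_factors_gt0 q0 q1 d0 d1 db bq c20 cq xN.
rewrite /qRacah_ratio ltr_pdivrMr ?mulr_gt0// [ltRHS]mulrAC ltr_pdivlMr ?mulr_gt0//.
move: h1 h3 h4 h5 h6 g1 h8 h9 g2 M0.
move: (q ^+ x) (q ^+ N) => Q M h1 h3 h4 h5 h6 g1 h8 h9 g2 M0.
rewrite -subr_gt0 [ltRHS](_ : _ =
  (1 - b * q * Q) * (q * Q - M) * (1 - d * Q) * (q * (1 - q * Q) * (1 - d * M * Q)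
   * (b - d * Q)) * M * (c2 - c1) * (1 - d * q * Q ^+ 2)); last by ring.
by rewrite !mulr_gt0// subr_gt0.
Qed.

(** Here the relevant quotient is (1 - b q Q) / (b - d Q), with cross-multiplied difference (b2 -
    b1) (1 - d q Q^2). The ratio decreases in b = q^beta and so increases in beta. *)
Lemma qRacah_ratio_lt_b (R : realType) (q d b1 b2 c : R) N x :
  0 < q -> q < 1 -> 0 < d -> d < 1 -> d < b1 -> b1 < b2 -> b2 * q < 1 ->
  0 < c -> c * q < 1 -> (x.+1 < N)%N ->
  qRacah_ratio q d b2 c N x < qRacah_ratio q d b1 c N x.
Proof.
move=> q0 q1 d0 d1 db1 b12 b2q c0 cq xN.
have db2 : d < b2 by exact: lt_trans b12.
have b1q : b1 * q < 1 by rewrite (lt_trans _ b2q)// ltr_pM2r.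
have [[_ h2 h3 h4] [h5 h6 h7 g1 h9]] := qRacah_factors_gt0 q0 q1 d0 d1 db1 b1q c0 cq xN.
have [_ [_ _ _ g2 _]] := qRacah_factors_gt0 q0 q1 d0 d1 db2 b2q c0 cq xN.
rewrite /qRacah_ratio ltr_pdivrMr ?mulr_gt0// [ltRHS]mulrAC ltr_pdivlMr ?mulr_gt0//.
move: h2 h3 h4 h5 h6 h7 g1 g2 h9.
move: (q ^+ x) (q ^+ N) => Q M h2 h3 h4 h5 h6 h7 g1 g2 h9.
rewrite -subr_gt0 [ltRHS](_ : _ =
  (1 - d * c * M * Q) * (q * Q - M) * (1 - d * Q) * (q * (1 - q * Q) * (1 - d * M * Q)
   * (q * Q - c * M)) * (b2 - b1) * (1 - d * q * Q ^+ 2)); last by ring.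
by rewrite !mulr_gt0// subr_gt0.
Qed.

(** * Transfer to the polynomials [qRacah] *)

Lemma size_qRacah_basis (R : realType) (q a : R) k : 0 < q ->
  size (qRacah_basis q a k) = k.+1.
Proof.
move=> q0; rewrite /qRacah_basis; elim: k => [|k IHk].
  by rewrite big_ord0 size_poly1.
have A0 : 2 * (q `^ a * q ^+ k) != 0.
  by rewrite !mulf_neq0 ?pnatr_eq0 ?gt_eqF ?powR_gt0 ?exprn_gt0.
rewrite big_ord_recr /=; set f := _%:P - _.
have size_f : size f = 2.
  rewrite /f addrC -scaleNr size_polyDl size_scale ?oppr_eq0 ?size_polyX//.
  by rewrite ltnS size_polyC_leq1.
by rewrite size_mul -?size_poly_eq0 ?IHk ?size_f ?addn2.
Qed.

Lemma orthogonal_below_basis (R : fieldType) N n (w y : nat -> R) (p : {poly R})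
    (B : nat -> {poly R}) :
  (forall k, size (B k) = k.+1) ->
  (forall k, (k < n)%N -> nodesum N w y (p * B k) = 0) -> orthogonal_below N w y n p.
Proof.
move=> size_B; elim: n => [|n IHn] orthB f.
  by rewrite leqn0 size_poly_eq0 => /eqP->; rewrite mulr0 nodesum0.
move=> size_f; have Bn0 : (B n)`_n != 0.
  rewrite -[X in _`_X]/(n.+1.-1) -(size_B n) -lead_coefE.
  by rewrite lead_coef_eq0 -size_poly_eq0 size_B.
pose g := f - (f`_n / (B n)`_n) *: B n.
have -> : f = g + (f`_n / (B n)`_n) *: B n by rewrite subrK.
rewrite mulrDr -scalerAr nodesumD nodesumZ orthB// mulr0 addr0.
apply: IHn => [k kn|]; first by rewrite orthB// ltnW.
apply/leq_sizeP => i; rewrite leq_eqVlt coefB coefZ => /orP[/eqP<-|ni].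
  by rewrite divfK// subrr.
have fi : f`_i = 0 by apply: nth_default; apply: leq_trans ni.
have Bi : (B n)`_i = 0 by apply: nth_default; rewrite size_B.
by rewrite fi Bi mulr0 subrr.
Qed.

Lemma gtr_powR (R : realType) (q : R) : 0 < q -> q < 1 ->
  {homo powR q : x y / x < y >-> y < x}.
Proof.
move=> q0 q1 x y xy.
by rewrite /powR gt_eqF// ltr_expR ltr_nM2r// ln_lt0 ?q0.
Qed.

Lemma powR_lt1 (R : realType) (q x : R) : 0 < q -> q < 1 -> 0 < x -> q `^ x < 1.
Proof. by move=> q0 q1 x0; rewrite -[ltRHS](powRr0 q) gtr_powR. Qed.

(** As a > 0, q^(a+x) stays in ]0, 1[, where u + 1/u is decreasing, and it decreases in x. *)
Lemma qRacah_node_lt (R : realType) (q a : R) : 0 < q -> q < 1 -> 0 < a ->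
  {homo (fun x => qlattice q (a + x%:R)) : k l / (k < l)%N >-> k < l}.
Proof.
move=> q0 q1 a0 k l kl; rewrite /qlattice ltr_pM2r ?invr_gt0// !powRN.
set u := q `^ (a + k%:R); set v := q `^ (a + l%:R).
have u0 : 0 < u by rewrite powR_gt0.
have v0 : 0 < v by rewrite powR_gt0.
have vu : v < u by rewrite gtr_powR// ltrD2l ltr_nat.
have u1 : u < 1 by rewrite powR_lt1// ltr_wpDr.
have v1 : v < 1 by exact: lt_trans u1.
rewrite -subr_gt0 [ltRHS](_ : _ = (u - v) * (1 - u * v) / (u * v)).
  by rewrite divr_gt0 ?mulr_gt0 ?subr_gt0// mulr_ilt1 ?ltW.
by field; rewrite !gt_eqF.
Qed.

Lemma powR_mul_lt1 (R : realType) (q z : R) : 0 < q -> q < 1 -> -1 < z ->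
  q `^ z * q < 1.
Proof.
move=> q0 q1 z1; rewrite -[X in _ * X]powRr1 ?ltW// -powRD; last first.
  by rewrite (gt_eqF q0) implybT.
by rewrite powR_lt1// -ltrBlDr sub0r.
Qed.

Lemma qRacah_orthogonal (R : realType) (q a alpha beta : R) N n :
  0 < q -> q < 1 -> 0 < a -> -1 < alpha -> -1 < beta -> beta < 2 * a ->
  (0 < n)%N -> (n < N)%N ->
  size (qRacah q N n a alpha beta) = n.+1 /\
  orthogonal_below N (qRacah_weight q (q `^ (2 * a)) (q `^ beta) (q `^ alpha) N)
    (fun x => qlattice q (a + x%:R)) n (qRacah q N n a alpha beta).
Proof.
move=> q0 q1 a0 al be be2a n0 nN.
have q_neq0 : q != 0 by rewrite gt_eqF.
have powD x y : q `^ (x + y) = q `^ x * q `^ y by rewrite powRD// q_neq0 implybT.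
have powN (k : nat) : q `^ k%:R = q ^+ k by rewrite powR_mulrn// ltW.
have pow1 : q `^ 1 = q by rewrite powRr1// ltW.
have c_gt0 : 0 < q `^ alpha by rewrite powR_gt0.
have d_gt0 : 0 < q `^ (2 * a) by rewrite powR_gt0.
have d_lt1 : q `^ (2 * a) < 1 by rewrite powR_lt1// mulr_gt0.
have d_lt_b : q `^ (2 * a) < q `^ beta by rewrite gtr_powR.
have bq_lt1 : q `^ beta * q < 1 by exact: powR_mul_lt1.
have cq_lt1 : q `^ alpha * q < 1 by exact: powR_mul_lt1.
(* At s = a + x one has q^(a-s) = q^(-x) and q^(s+a) = d q^x. *)
have B_phi k x : (qRacah_basis q a k).[qlattice q (a + x%:R)] =
    qRacah_phi q (q `^ (2 * a)) k x.
  rewrite qRacah_basisE// /qRacah_phi; congr (qpoch _ _ _ * qpoch _ _ _).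
    by rewrite opprD addrA subrr sub0r powRN powN.
  by rewrite -powN -powD; congr (_ `^ _); ring.
have coefE k : qRacah_coef q N n a alpha beta k =
    qRacah_eigencoef q (q `^ (2 * a)) (q `^ beta) (q `^ alpha) N n k.
  rewrite /qRacah_coef /qRacah_eigencoef powRN !powD powRN !powN pow1.
  rewrite (_ : q `^ alpha * q `^ beta * q ^+ n * q = q `^ beta * q `^ alpha * q * q ^+ n)//.
  by ring.
have pE : qRacah q N n a alpha beta =
    qRacah_sum q (q `^ (2 * a)) (q `^ beta) (q `^ alpha) N (qRacah_basis q a) n.
  by apply: eq_bigr => k _; rewrite coefE.
split; last first.
  apply: (orthogonal_below_basis (B := qRacah_basis q a)) => [k|k kn].
    exact: size_qRacah_basis.
  rewrite pE; exact: (qRacah_sum_orthogonal q0 q1 d_gt0 d_lt1 d_lt_b bq_lt1 c_gt0 cq_lt1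
    B_phi kn nN).
have coef_n0 : qRacah_coef q N n a alpha beta n != 0.
  by rewrite coefE; apply: qRacah_eigencoef_neq0; rewrite ?n0.
have size_last : size (qRacah_coef q N n a alpha beta n *: qRacah_basis q a n) = n.+1.
  by rewrite size_scale ?size_qRacah_basis.
rewrite /qRacah big_ord_recr /= addrC size_polyDl size_last// ltnS.
rewrite (leq_trans (size_sum _ _ _))//; apply/bigmax_leqP => k _.
by rewrite (leq_trans (size_scale_leq _ _))// size_qRacah_basis.
Qed.

(** * Monotonicity of the zeros *)

Lemma qRacah_zero_lt (R : realType) (q a alpha1 beta1 alpha2 beta2 : R) N n i :
  0 < q -> q < 1 -> 0 < a -> -1 < alpha1 -> -1 < beta1 < 2 * a ->
  -1 < alpha2 -> -1 < beta2 < 2 * a -> (n < N)%N -> (i < n)%N ->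
  (forall x, (x.+1 < N)%N ->
    qRacah_ratio q (q `^ (2 * a)) (q `^ beta1) (q `^ alpha1) N x <
    qRacah_ratio q (q `^ (2 * a)) (q `^ beta2) (q `^ alpha2) N x) ->
  qRacah_zero q N n a alpha1 beta1 i < qRacah_zero q N n a alpha2 beta2 i.
Proof.
move=> q0 q1 a0 al1 /andP[be1 be1a] al2 /andP[be2 be2a] nN i_n ratio_lt.
have n0 : (0 < n)%N by exact: leq_ltn_trans i_n.
have d_gt0 : 0 < q `^ (2 * a) by rewrite powR_gt0.
have d_lt1 : q `^ (2 * a) < 1 by rewrite powR_lt1// mulr_gt0.
have [size1 orth1] := qRacah_orthogonal q0 q1 a0 al1 be1 be1a n0 nN.
have [size2 orth2] := qRacah_orthogonal q0 q1 a0 al2 be2 be2a n0 nN.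
have bounds al be : -1 < al -> -1 < be -> be < 2 * a ->
    [/\ q `^ (2 * a) < q `^ be, q `^ be * q < 1, 0 < q `^ al & q `^ al * q < 1].
  by move=> hal hbe hbea; rewrite gtr_powR ?powR_gt0 ?powR_mul_lt1.
have [db1 bq1 c1 cq1] := bounds _ _ al1 be1 be1a.
have [db2 bq2 c2 cq2] := bounds _ _ al2 be2 be2a.
apply: (orthogonal_rootsR_lt nN _ _ _ _ size1 size2 orth1 orth2 i_n).
- by move=> k l _ _; apply: qRacah_node_lt.
- by move=> x; apply: qRacah_weight_gt0.
- by move=> x; apply: qRacah_weight_gt0.
apply: weight_ratio_lt => [x _|j jN].
  rewrite subr_gt0 (le_lt_trans _ d_lt1)// ler_piMr ?(ltW d_gt0)// -exprM.
  by rewrite exprn_ile1// ltW.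
by rewrite qRacah_ratio_gt0//= ratio_lt.
Qed.

Lemma qRacah_zero_decr_alpha (R : realType) (q a beta : R) N n i :
  0 < q -> q < 1 -> 0 < a -> (n < N)%N -> (i < n)%N -> -1 < beta < 2 * a ->
  {in `]-1, +oo[ &, {homo (fun alpha => qRacah_zero q N n a alpha beta i) :
        x y / x < y >-> y < x}}.
Proof.
move=> q0 q1 a0 nN i_n be x y; rewrite !in_itv/= !andbT => x1 y1 xy.
have /andP[be1 be2a] := be.
apply: qRacah_zero_lt => // j jN; apply: qRacah_ratio_lt_c;
  rewrite ?powR_gt0 ?powR_mul_lt1//.
- by rewrite powR_lt1// mulr_gt0.
- exact: gtr_powR.
exact: gtr_powR.
Qed.

Lemma qRacah_zero_incr_beta (R : realType) (q a alpha : R) N n i :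
  0 < q -> q < 1 -> 0 < a -> (n < N)%N -> (i < n)%N -> -1 < alpha ->
  {in `]-1, (2 * a)[ &, {homo (fun beta => qRacah_zero q N n a alpha beta i) :
        x y / x < y}}.
Proof.
move=> q0 q1 a0 nN i_n al x y; rewrite !in_itv/= => x1 y1 xy.
have /andP[x_1 x_2a] := x1; have /andP[y_1 y_2a] := y1.
apply: qRacah_zero_lt => // j jN; apply: qRacah_ratio_lt_b;
  rewrite ?powR_gt0 ?powR_mul_lt1//.
- by rewrite powR_lt1// mulr_gt0.
- exact: gtr_powR.
exact: gtr_powR.
Qed.

Theorem proposition3p16 (R : realType) (q a : R) (N n : nat)
    (q_gt0 : 0 < q) (q_lt1 : q < 1) (n_gt0 : (0 < n)%N) (n_ltN : (n < N)%N)
    (a_gt0 : 0 < a) :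
  (2^-1 <= a ->
    (forall (beta : R) (i : 'I_n), beta \in `]-1, (2 * a)[ ->
      {in `]-1, +oo[ &, {homo (fun alpha => qRacah_zero q N n a alpha beta i) :
        x y / x < y >-> y < x}}) /\
    (forall (alpha : R) (i : 'I_n), alpha \in `]-1, +oo[ ->
      {in `]-1, (2 * a)[ &, {homo (fun beta => qRacah_zero q N n a alpha beta i) :
        x y / x < y}}))
  /\
  (a < 2^-1 ->
    (forall (beta : R) (i : 'I_n), beta \in `](a - 2^-1), (2 * a)[ ->
      {in `]-1, +oo[ &, {homo (fun alpha => qRacah_zero q N n a alpha beta i) :
        x y / x < y >-> y < x}}) /\
    (forall (alpha : R) (i : 'I_n), alpha \in `]-1, +oo[ ->
      {in `](a - 2^-1), (2 * a)[ &, {homo (fun beta => qRacah_zero q N n a alpha beta i) :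
        x y / x < y}})).
Proof.
have decr beta (i : 'I_n) : -1 < beta < 2 * a ->
    {in `]-1, +oo[ &, {homo (fun alpha => qRacah_zero q N n a alpha beta i) :
      x y / x < y >-> y < x}}.
  by move=> beta_in; apply: qRacah_zero_decr_alpha.
have incr alpha (i : 'I_n) : alpha \in `]-1, +oo[ ->
    {in `]-1, (2 * a)[ &, {homo (fun beta => qRacah_zero q N n a alpha beta i) :
      x y / x < y}}.
  by rewrite in_itv /= andbT => alpha_gt; apply: qRacah_zero_incr_beta.
split=> _; first by split=> // beta i; rewrite in_itv; apply: decr.
(* Since a > 0, a - 1/2 exceeds -1. *)
have sub beta : beta \in `](a - 2^-1), (2 * a)[ -> beta \in `]-1, (2 * a)[.
  by rewrite !in_itv /= => /andP[beta_gt ->]; rewrite andbT; lra.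
split=> [beta i /sub|alpha i alpha_in x y /sub x_in /sub y_in].
  by rewrite in_itv; apply: decr.
exact: incr.
Qed.
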